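(* Let $N$ be a normal subgroup of a group $G$ such that the quotient group $G/N$ satisfies the maximality condition (ascending chain condition) for normal subgroups. Then $G$ contains characteristic subgroups $H_1,H_2,\dots$ such that for every $t\ge1$: 1) the quotient group $G/H_t$ lies in the coradical class (formation) $\mathcal F$ generated by $G/N$; moreover, $H_t$ belongs to the sublattice of the lattice of subgroups of $G$ generated by the images of $N$ under all automorphisms of $G$; 2) for every outer (multilinear) commutator word $w$ of weight $k\le t$, the group $w(H_t,\dots,H_t)$ is contained in the radical class $\mathcal R_w$ generated by the group $w(N,\dots,N)$; 3) if $\operatorname{codim}$ is a generalised $(\operatorname{Aut}G)$-codimension on the lattice of normal subgroups $K$ of $G$ with $G/K\in\mathcal F$, then $\operatorname{codim}H_t\le f^{t-1}(\operatorname{codim}N)$, where $f^k$ is the $k$th iterate of the function $f(x)=x(x+1)$ (with $f^0$ the identity).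
   Context: An outer (multilinear) commutator of weight (degree) 1 is a letter $x_i$; an outer commutator of weight $t>1$ is a word $w(x_1,\dots,x_t)=[u(x_1,\dots,x_r),v(x_{r+1},\dots,x_t)]$ in a free group, where $u,v$ are outer commutators of weights $r$ and $t-r$ (all letters distinct). For normal subgroups $K_1,\dots,K_t$ of $G$, $w(K_1,\dots,K_t)$ denotes the subgroup generated by all $w(h_1,\dots,h_t)$ with $h_i\in K_i$. A radical (Fitting) class is an isomorphism-closed class of groups such that normal subgroups of groups in the class are in the class, and a group that is a product of two normal subgroups lying in the class is in the class. A coradical class (formation) is an isomorphism-closed class of groups closed under quotient groups and under subdirect products of two groups. The radical (coradical) class generated by a group is the smallest such class containing it. Let $\mathcal L$ be the lattice of normal subgroups $K$ of $G$ with $G/K\in\mathcal F$, ordered by inclusion (sup is the product, inf is the intersection); $\operatorname{Aut}G$ acts on it. A function $\operatorname{codim}\colon\mathcal L\to\mathbb R$ is a generalised $(\operatorname{Aut}G)$-codimension if: (1) $\operatorname{codim}N_1\le\operatorname{codim}N_2$ whenever $N_1\supseteq N_2$; (2) $\operatorname{codim}\phi(K)\le\operatorname{codim}K$ for all $K\in\mathcal L$, $\phi\in\operatorname{Aut}G$; (3) $\operatorname{codim}(N_1\cap N_2)\le\operatorname{codim}N_1+\operatorname{codim}N_2$; (4) every nonempty family $\mathcal N\subseteq\mathcal L$ on which codim is bounded above contains elements $N_1,\dots,N_r$ with $r\le\sup_{K\in\mathcal N}\operatorname{codim}K+1$ such that the supremum (product) of $\mathcal N$ equals $N_1\cdots N_r$.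 *)

(* Defs.v *)
From HB Require Import structures.
From mathcomp Require Import all_boot all_order all_algebra generic_quotient.
From mathcomp Require Import boolp classical_sets reals.

Set Implicit Arguments.
Unset Strict Implicit.
Unset Printing Implicit Defensive.

Import Order.TTheory GRing.Theory Num.Theory.

Local Open Scope classical_set_scope.
Local Open Scope group_scope.
Local Open Scope quotient_scope.

(* Groups are arbitrary, possibly infinite: [groupType] asks for a choiceType
   carrier, which by the axioms of [boolp] is no restriction. *)

Definition is_subgroup (G : groupType) (A : set G) : Prop :=
  [/\ A 1, forall x y, A x -> A y -> A (x * y) & forall x, A x -> A x^-1].

Record subgroup (G : groupType) := Subgroup {
  subgroup_set :> set G;
  subgroupP : is_subgroup subgroup_set }.

Record nsubgroup (G : groupType) := NSubgroup {
  nsubgroup_subgroup :> subgroup G;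
  nsubgroupP : forall x y : G, subgroup_set nsubgroup_subgroup x ->
    subgroup_set nsubgroup_subgroup (x ^ y) }.

Lemma gen_is_subgroup (G : groupType) (A : set G) :
  is_subgroup (smallest (@is_subgroup G) A).
Proof.
split=> [B [[]] //|x y Ax Ay B BP|x Ax B BP].
- by case: (BP) => -[_ + _] _; apply; [apply: Ax|apply: Ay].
- by case: (BP) => -[_ _ +] _; apply; apply: Ax.
Qed.

Definition gen (G : groupType) (A : set G) : subgroup G :=
  Subgroup (gen_is_subgroup A).

Lemma meet_is_subgroup (G : groupType) (A B : subgroup G) :
  is_subgroup (A `&` B).
Proof.
case: A B => [A [A1 AM AV]] [B [B1 BM BV]]; split=> //= [x y [? ?] [? ?]|x [? ?]].
- by split; [apply: AM|apply: BM].
- by split; [apply: AV|apply: BV].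
Qed.

Definition subgroup_meet (G : groupType) (A B : subgroup G) : subgroup G :=
  Subgroup (meet_is_subgroup A B).

Definition subgroup_join (G : groupType) (A B : subgroup G) : subgroup G :=
  gen (A `|` B).

Lemma meet_normal (G : groupType) (A B : nsubgroup G) (x y : G) :
  subgroup_set (subgroup_meet A B) x -> subgroup_set (subgroup_meet A B) (x ^ y).
Proof. by case=> Ax Bx; split; apply: nsubgroupP. Qed.

Definition nsubgroup_meet (G : groupType) (A B : nsubgroup G) : nsubgroup G :=
  NSubgroup (@meet_normal G A B).

Definition in_sublattice_gen (G : groupType) (S : set (subgroup G))
    (H : subgroup G) : Prop :=
  forall L : set (subgroup G), S `<=` L ->
    (forall A B, L A -> L B -> L (subgroup_meet A B)) ->
    (forall A B, L A -> L B -> L (subgroup_join A B)) ->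
    L H.

Record aut (G : groupType) := Aut {
  aut_fun :> {multiplicative G -> G};
  aut_bij : bijective aut_fun }.

Section AutImage.
Variables (G : groupType) (phi : aut G).

Lemma autM : {morph phi : x y / x * y}. Proof. exact: gmulfM. Qed.

Lemma aut1 : phi 1 = 1.
Proof. by apply: (mulgI (phi 1)); rewrite -autM !mulg1. Qed.

Lemma autV : {morph phi : x / x^-1}.
Proof. by move=> x; apply: (mulgI (phi x)); rewrite -autM !mulgV aut1. Qed.

Lemma aut_image_is_subgroup (A : subgroup G) : is_subgroup (phi @` A).
Proof.
case: A => A [A1 AM AV] /=; split=> [|_ _ [x Ax <-] [y Ay <-]|_ [x Ax <-]].
- by exists 1 => //; rewrite aut1.
- by exists (x * y); [apply: AM|rewrite autM].
- by exists x^-1; [apply: AV|rewrite autV].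
Qed.

Definition aut_image (A : subgroup G) : subgroup G :=
  Subgroup (aut_image_is_subgroup A).

Lemma aut_image_normal (K : nsubgroup G) (x y : G) :
  subgroup_set (aut_image K) x -> subgroup_set (aut_image K) (x ^ y).
Proof.
case: (aut_bij phi) => psi _ psiK [z Kz <-].
exists (z ^ psi y); first exact: nsubgroupP.
by rewrite !conjgE !autM autV psiK.
Qed.

Definition aut_nimage (K : nsubgroup G) : nsubgroup G :=
  NSubgroup (@aut_image_normal K).

End AutImage.

Definition is_characteristic (G : groupType) (H : subgroup G) : Prop :=
  forall phi : aut G, phi @` H = H :> set G.

Definition subgroup_group (G : groupType) (H : subgroup G) : Type :=
  set_type (subgroup_set H).

Section GroupOf.
Variables (G : groupType) (H : subgroup G).

HB.instance Definition _ := SubChoice.on (subgroup_group H).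

Lemma subgroup_group_closed : group_closed [pred x : G | x \in subgroup_set H].
Proof.
case: H => A [A1 AM AV] /=; split=> [|x y]; rewrite !inE //.
by move=> Ax Ay; apply: AM => //; apply: AV.
Qed.

HB.instance Definition _ :=
  SubChoice_isSubGroup.Build G (fun x => x \in subgroup_set H) (subgroup_group H)
    subgroup_group_closed.

End GroupOf.

Section Quotient.
Variables (G : groupType) (N : nsubgroup G).

Definition coset_eq (x y : G) : bool := `[< subgroup_set N (x^-1 * y) >].

Lemma coset_eq_refl : reflexive coset_eq.
Proof. by move=> x; apply/asboolP; rewrite mulVg; case: (subgroupP N). Qed.

Lemma coset_eq_sym : symmetric coset_eq.
Proof.
suff h x y : coset_eq x y -> coset_eq y x by move=> x y; apply/idP/idP => /h.
have [_ _ NV] := subgroupP N.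
by move=> /asboolP /NV; rewrite invgM invgK => h; apply/asboolP.
Qed.

Lemma coset_eq_trans : transitive coset_eq.
Proof.
have [_ NM _] := subgroupP N.
move=> y x z /asboolP xy /asboolP yz; apply/asboolP.
by have := NM _ _ xy yz; rewrite mulgA mulgK.
Qed.

Canonical coset_equiv :=
  EquivRel coset_eq coset_eq_refl coset_eq_sym coset_eq_trans.

Definition quotient_group : Type := {eq_quot coset_equiv}.

HB.instance Definition _ := Choice.on quotient_group.
HB.instance Definition _ := EqQuotient.on quotient_group.

Definition quotient_one : quotient_group := \pi_quotient_group 1.
Definition quotient_mul (a b : quotient_group) : quotient_group :=
  \pi_quotient_group (repr a * repr b).
Definition quotient_inv (a : quotient_group) : quotient_group :=
  \pi_quotient_group (repr a)^-1.

Lemma quotient_piP (x y : G) :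
  subgroup_set N (x^-1 * y) <-> \pi_quotient_group x = \pi_quotient_group y.
Proof.
split=> [h|/eqmodP /asboolP //].
by apply/eqmodP; apply/asboolP.
Qed.

Lemma quotient_piM (x y : G) :
  quotient_mul (\pi x) (\pi y) = \pi_quotient_group (x * y).
Proof.
rewrite /quotient_mul; apply/esym/quotient_piP.
case: piP => x' /quotient_piP xx'; case: piP => y' /quotient_piP yy'.
have -> : (x * y)^-1 * (x' * y') = (x^-1 * x') ^ y * (y^-1 * y').
  by rewrite conjgE invgM !mulgA mulgK.
by have [_ NM _] := subgroupP N; apply: NM => //; apply: nsubgroupP.
Qed.

Lemma quotient_piV (x : G) : quotient_inv (\pi x) = \pi_quotient_group x^-1.
Proof.
rewrite /quotient_inv; apply/esym/quotient_piP.
case: piP => x' /quotient_piP xx'.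
have [_ _ NV] := subgroupP N.
have -> : x^-1^-1 * x'^-1 = (x^-1 * x')^-1 ^ x^-1.
  by rewrite conjgE invgM !invgK !mulgA mulgK.
by apply: nsubgroupP; apply: NV.
Qed.

Lemma quotient_mulA : associative quotient_mul.
Proof.
elim/quotW=> x; elim/quotW=> y; elim/quotW=> z.
by rewrite !quotient_piM mulgA.
Qed.

Lemma quotient_mul1g : left_id quotient_one quotient_mul.
Proof. by elim/quotW=> x; rewrite quotient_piM mul1g. Qed.

Lemma quotient_mulg1 : right_id quotient_one quotient_mul.
Proof. by elim/quotW=> x; rewrite quotient_piM mulg1. Qed.

Lemma quotient_mulVg : left_inverse quotient_one quotient_inv quotient_mul.
Proof. by elim/quotW=> x; rewrite quotient_piV quotient_piM mulVg. Qed.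

Lemma quotient_mulgV : right_inverse quotient_one quotient_inv quotient_mul.
Proof. by elim/quotW=> x; rewrite quotient_piV quotient_piM mulgV. Qed.

HB.instance Definition _ := isGroup.Build quotient_group
  quotient_mulA quotient_mul1g quotient_mulg1 quotient_mulVg quotient_mulgV.

End Quotient.

Definition max_normal (G : groupType) : Prop :=
  forall K : nat -> nsubgroup G,
    (forall i, K i `<=` K i.+1) ->
    exists n, forall m, (n <= m)%N -> K m = K n :> set G.

Definition group_class := groupType -> Prop.

Definition isomorphic (X Y : groupType) : Prop :=
  exists f : {multiplicative X -> Y}, bijective f.

Definition iso_closed (C : group_class) : Prop :=
  forall X Y : groupType, isomorphic X Y -> C X -> C Y.

Definition is_radical_class (C : group_class) : Prop :=
  [/\ iso_closed C,
      forall (X : groupType) (K : nsubgroup X), C X -> C (subgroup_group K) &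
      forall (X : groupType) (A B : nsubgroup X),
        C (subgroup_group A) -> C (subgroup_group B) ->
        (forall x : X, exists2 a, subgroup_set A a &
           exists2 b, subgroup_set B b & x = a * b) -> C X].

Definition is_coradical_class (C : group_class) : Prop :=
  [/\ iso_closed C,
      forall (X : groupType) (K : nsubgroup X), C X -> C (quotient_group K) &
      forall (A B : groupType) (S : subgroup (A * B)%type),
        C A -> C B ->
        (forall a, exists b, subgroup_set S (a, b)) -> (forall b, exists a, subgroup_set S (a, b)) ->
        C (subgroup_group S)].

Definition radical_class_gen (X : groupType) : group_class :=
  fun Y => forall C : group_class, is_radical_class C -> C X -> C Y.

Definition coradical_class_gen (X : groupType) : group_class :=
  fun Y => forall C : group_class, is_coradical_class C -> C X -> C Y.

(* [outer_comm t] is the type of outer commutators of weight [t]; the letters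
   are implicit, the leaves being numbered from left to right. *)
Inductive outer_comm : nat -> Type :=
| oc_letter : outer_comm 1
| oc_comm r s : outer_comm r -> outer_comm s -> outer_comm (r + s).

Fixpoint oc_eval (G : groupType) t (w : outer_comm t) : ('I_t -> G) -> G :=
  match w in outer_comm t0 return ('I_t0 -> G) -> G with
  | oc_letter => fun h => h ord0
  | oc_comm r s u v => fun h =>
      [~ oc_eval u (fun i => h (lshift s i)), oc_eval v (fun i => h (rshift r i))]
  end.

Definition oc_subgroup (G : groupType) t (w : outer_comm t)
    (K : 'I_t -> nsubgroup G) : subgroup G :=
  gen [set oc_eval w h | h in [set h : 'I_t -> G | forall i, subgroup_set (K i) (h i)]].

Definition nsubgroup_prod (G : groupType) r (K : 'I_r -> nsubgroup G) : set G :=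
  [set \prod_(i < r) x i | x in [set x : 'I_r -> G | forall i, subgroup_set (K i) (x i)]].

Local Open Scope ring_scope.

(* [L] is the lattice on which the codimension lives: the values of [codim]
   outside [L] are unconstrained. *)
Record is_gen_codim (R : realType) (G : groupType) (L : set (nsubgroup G))
    (codim : nsubgroup G -> R) : Prop := IsGenCodim {
  codim_anti : forall N1 N2, L N1 -> L N2 ->
    N2 `<=` N1 -> codim N1 <= codim N2;
  codim_aut : forall K (phi : aut G), L K ->
    codim (aut_nimage phi K) <= codim K;
  codim_meet : forall N1 N2, L N1 -> L N2 ->
    codim (nsubgroup_meet N1 N2) <= codim N1 + codim N2;
  codim_join : forall F : set (nsubgroup G), F `<=` L -> F !=set0 ->
    has_ubound (codim @` F) ->
    exists r (M : 'I_r -> nsubgroup G),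
      [/\ (0 < r)%N, r%:R <= sup (codim @` F) + 1, forall i, F (M i) &
          gen (\bigcup_(K in F) (K : set G)) = nsubgroup_prod M :> set G] }.

(* Main.v *)
(* The product of all automorphic images of a normal subgroup [M] (its hull) is
   already the product of finitely many of them, by the chain condition; let the
   core of [M] be the intersection of the images in such a product with as few
   factors as possible.  Starting from [N_1 = N], let [N_(t+1)] be the core of
   [N_t] and [H_t] the hull of [N_t].  Condition (4) bounds the number of factors
   by [codim N_t + 1], so (3) gives
   [codim N_(t+1) <= codim N_t * (codim N_t + 1)].
   For a commutator [w] of weight [k], multilinearity reduces [w(H_k, ..., H_k)],
   one coordinate after the other, to finitely many subgroups in which the
   coordinates treated so far lie in one image of [N_j] and the others in
   [H_(j-1)]; at the end the former fill all coordinates and [j = 1].  Hence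
   [w(H_k, ..., H_k)] is a normal subgroup of a product of finitely many images
   of [w(N, ..., N)]. *)
Require Import Defs.
From HB Require Import structures.
From mathcomp Require Import all_boot all_order all_algebra generic_quotient.
From mathcomp Require Import boolp classical_sets reals.

Set Implicit Arguments.
Unset Strict Implicit.
Unset Printing Implicit Defensive.

Import Order.TTheory GRing.Theory Num.Theory.

Local Open Scope classical_set_scope.
Local Open Scope group_scope.
Local Open Scope quotient_scope.

(** * Elementary facts on subgroups and generated subgroups *)

Lemma subgroup1 (G : groupType) (A : subgroup G) : subgroup_set A 1.
Proof. by case: (subgroupP A). Qed.

Lemma subgroupM (G : groupType) (A : subgroup G) x y :
  subgroup_set A x -> subgroup_set A y -> subgroup_set A (x * y).
Proof. by case: (subgroupP A) => _ + _; apply. Qed.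

Lemma subgroupV (G : groupType) (A : subgroup G) x :
  subgroup_set A x -> subgroup_set A x^-1.
Proof. by case: (subgroupP A) => _ _; apply. Qed.

Lemma subgroup_inj (G : groupType) (A B : subgroup G) :
  A = B :> set G -> A = B.
Proof.
case: A B => A PA [B PB] /= eqAB; rewrite eqAB in PA *.
by congr Subgroup; apply: Prop_irrelevance.
Qed.

Lemma nsubgroup_inj (G : groupType) (A B : nsubgroup G) :
  A = B :> set G -> A = B.
Proof.
case: A B => A PA [B PB] /= /subgroup_inj eqAB; rewrite eqAB in PA *.
by congr NSubgroup; apply: Prop_irrelevance.
Qed.

Lemma sub_gen (G : groupType) (A : set G) : A `<=` gen A.
Proof. by move=> x Ax B [_]; apply. Qed.

Lemma gen_sub (G : groupType) (A : set G) (B : subgroup G) :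
  A `<=` B -> gen A `<=` B.
Proof. by move=> AB x; apply; split=> //; apply: subgroupP. Qed.

(** * Morphisms and isomorphisms *)

(* The library states [gmulf1], [gmulfV], ... for morphisms that carry a proof
   of [f 1 = 1], which is redundant between groups. *)
Lemma multiplicative1 (X Y : groupType) (f : {multiplicative X -> Y}) : f 1 = 1.
Proof. by apply: (mulgI (f 1)); rewrite -gmulfM !mulg1. Qed.

Lemma multiplicativeV (X Y : groupType) (f : {multiplicative X -> Y}) :
  {morph f : x / x^-1}.
Proof.
by move=> x; apply: (mulgI (f x)); rewrite -gmulfM !mulgV multiplicative1.
Qed.

Lemma multiplicativeJ (X Y : groupType) (f : {multiplicative X -> Y}) :
  {morph f : x y / x ^ y}.
Proof. by move=> x y; rewrite !conjgE !gmulfM multiplicativeV. Qed.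

Lemma multiplicativeR (X Y : groupType) (f : {multiplicative X -> Y}) :
  {morph f : x y / [~ x, y]}.
Proof. by move=> x y; rewrite !commgEl gmulfM multiplicativeJ multiplicativeV. Qed.

Lemma inj_surj_isomorphic (X Y : groupType) (f : {multiplicative X -> Y}) :
  injective f -> (forall y, exists x, f x = y) -> isomorphic X Y.
Proof.
move=> f_inj f_surj; exists f.
have fK y : f (projT1 (cid (f_surj y))) = y by case: cid.
by exists (fun y => projT1 (cid (f_surj y))) => // x; apply: f_inj.
Qed.

Lemma isomorphic_sym (X Y : groupType) : isomorphic X Y -> isomorphic Y X.
Proof.
case=> f [g fK gK].
pose g_mul := isMultiplicative.Build Y X g (can2_gmulfM fK gK).
by exists (HB.pack g g_mul : {multiplicative Y -> X}); exists f.
Qed.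

(** A named form of [val], so that the embedding can carry a structure of multiplicative
    morphism. *)
Definition incl (G : groupType) (A : subgroup G) (x : subgroup_group A) : G :=
  val x.

Lemma inclM (G : groupType) (A : subgroup G) : {morph @incl G A : x y / x * y}.
Proof. by move=> x y; rewrite /incl valM. Qed.

HB.instance Definition _ (G : groupType) (A : subgroup G) :=
  isMultiplicative.Build (subgroup_group A) G (@incl G A) (@inclM G A).

Lemma incl_inj (G : groupType) (A : subgroup G) : injective (@incl G A).
Proof. exact: val_inj. Qed.

Lemma incl_mem (G : groupType) (A : subgroup G) (x : subgroup_group A) :
  subgroup_set A (incl x).
Proof. exact/set_mem/valP. Qed.

Definition in_subgroup (G : groupType) (A : subgroup G) x
  (Ax : subgroup_set A x) : subgroup_group A := Sub x (mem_set Ax).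

Lemma incl_in_subgroup (G : groupType) (A : subgroup G) x
  (Ax : subgroup_set A x) : incl (in_subgroup Ax) = x.
Proof. exact: SubK. Qed.

Definition corestrict (X Y : groupType) (f : X -> Y) (B : subgroup Y)
    (fB : forall x, subgroup_set B (f x)) (x : X) : subgroup_group B :=
  in_subgroup (fB x).

Lemma incl_corestrict (X Y : groupType) (f : X -> Y) (B : subgroup Y)
    (fB : forall x, subgroup_set B (f x)) x : incl (corestrict fB x) = f x.
Proof. exact: incl_in_subgroup. Qed.

Lemma corestrictM (X Y : groupType) (f : {multiplicative X -> Y})
    (B : subgroup Y) (fB : forall x, subgroup_set B (f x)) :
  {morph corestrict fB : x y / x * y}.
Proof. by move=> x y; apply: incl_inj; rewrite inclM !incl_corestrict gmulfM. Qed.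

HB.instance Definition _ (X Y : groupType) (f : {multiplicative X -> Y})
    (B : subgroup Y) (fB : forall x, subgroup_set B (f x)) :=
  isMultiplicative.Build X (subgroup_group B) (corestrict fB) (corestrictM fB).

Lemma subgroup_group_isomorphic (X Y : groupType) (f : {multiplicative X -> Y})
    (A : subgroup X) (B : subgroup Y) :
  injective f -> f @` A = B -> isomorphic (subgroup_group A) (subgroup_group B).
Proof.
move=> f_inj fAB.
have fB (x : subgroup_group A) : subgroup_set B (f (incl x)).
  by rewrite -fAB; exists (incl x) => //; apply: incl_mem.
apply: (@inj_surj_isomorphic _ _ (corestrict (f := f \o @incl _ _) fB)) => [x y|y].
  by move=> /(congr1 (@incl _ _)); rewrite !incl_corestrict => /f_inj /incl_inj.
have [x Ax fx] : (f @` A) (incl y) by rewrite fAB; apply: incl_mem.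
by exists (in_subgroup Ax); apply: incl_inj; rewrite incl_corestrict /= incl_in_subgroup.
Qed.

Definition quotient_proj (G : groupType) (K : nsubgroup G) (x : G) :
  quotient_group K := \pi x.

Lemma quotient_projM (G : groupType) (K : nsubgroup G) :
  {morph quotient_proj K : x y / x * y}.
Proof. by move=> x y; rewrite /quotient_proj -quotient_piM. Qed.

HB.instance Definition _ (G : groupType) (K : nsubgroup G) :=
  isMultiplicative.Build G (quotient_group K) (quotient_proj K)
    (@quotient_projM G K).

Lemma quotient_proj_surj (G : groupType) (K : nsubgroup G) q :
  exists x, quotient_proj K x = q.
Proof. by exists (repr q); apply: reprK. Qed.

Lemma quotient_proj_eq (G : groupType) (K : nsubgroup G) x y :
  quotient_proj K x = quotient_proj K y <-> subgroup_set K (x^-1 * y).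
Proof. by split=> /quotient_piP. Qed.

Lemma quotient_proj_eq1 (G : groupType) (K : nsubgroup G) x :
  quotient_proj K x = 1 <-> subgroup_set K x.
Proof.
rewrite -(multiplicative1 (quotient_proj K)); split.
  by move=> /esym/quotient_proj_eq; rewrite invg1 mul1g.
by move=> Kx; apply/esym/quotient_proj_eq; rewrite invg1 mul1g.
Qed.

Lemma first_isomorphism (G Y : groupType) (K : nsubgroup G)
    (f : {multiplicative G -> Y}) :
  (forall y, exists x, f x = y) -> (forall x, f x = 1 <-> subgroup_set K x) ->
  isomorphic (quotient_group K) Y.
Proof.
move=> f_surj kerf; pose g (q : quotient_group K) := f (repr q).
(* The chosen representative of the coset of [x] differs from [x] by an element of [K], the kernel
   of [f], so [g] is the map induced by [f]. *)
have gE x : g (quotient_proj K x) = f x.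
  have /quotient_proj_eq/kerf := reprK (quotient_proj K x).
  by rewrite gmulfM multiplicativeV => /mulg1_eq; rewrite invgK.
have gM : {morph g : x y / x * y}.
  move=> a b; case: (quotient_proj_surj a) (quotient_proj_surj b) => x <- [y <-].
  by rewrite -gmulfM !gE gmulfM.
pose g_mul := isMultiplicative.Build _ _ g gM.
apply: (@inj_surj_isomorphic _ _ (HB.pack g g_mul : {multiplicative _ -> _})).
  move=> a b; case: (quotient_proj_surj a) (quotient_proj_surj b) => x <- [y <-].
  rewrite /= !gE => fxy; apply/quotient_proj_eq/kerf.
  by rewrite gmulfM multiplicativeV fxy mulVg.
by move=> y; case: (f_surj y) => x <-; exists (quotient_proj K x); apply: gE.
Qed.

(** * The lattice of normal subgroups *)

(** Normality of [B] moves its elements to the right: [a b a' b' = (a a') ((b ^ a') b')]. *)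
Lemma mul_is_subgroup (G : groupType) (A B : nsubgroup G) :
  is_subgroup [set x * y | x in subgroup_set A & y in subgroup_set B].
Proof.
split=> [|_ _ [a Aa [b Bb <-]] [a' Aa' [b' Bb' <-]]|_ [a Aa [b Bb <-]]].
- by exists 1; [|exists 1]; rewrite ?mulg1 //; apply: subgroup1.
- exists (a * a'); first exact: subgroupM.
  exists (b ^ a' * b'); first by apply: subgroupM => //; apply: nsubgroupP.
  by rewrite conjgE !mulgA mulgK.
- exists a^-1; first exact: subgroupV.
  exists (b^-1 ^ a^-1); first by apply: nsubgroupP; apply: subgroupV.
  by rewrite conjgE invgK invgM !mulgA mulVg mul1g.
Qed.

Lemma mul_normal (G : groupType) (A B : nsubgroup G) (x y : G) :
  subgroup_set (Subgroup (mul_is_subgroup A B)) x ->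
  subgroup_set (Subgroup (mul_is_subgroup A B)) (x ^ y).
Proof.
case=> a Aa [b Bb <-]; exists (a ^ y); first exact: nsubgroupP.
by exists (b ^ y); [apply: nsubgroupP|rewrite conjMg].
Qed.

Definition nsubgroup_mul (G : groupType) (A B : nsubgroup G) : nsubgroup G :=
  NSubgroup (@mul_normal G A B).

Lemma sub_mull (G : groupType) (A B : nsubgroup G) : A `<=` nsubgroup_mul A B.
Proof.
by move=> x Ax; exists x => //; exists 1; rewrite ?mulg1 //; apply: subgroup1.
Qed.

Lemma sub_mulr (G : groupType) (A B : nsubgroup G) : B `<=` nsubgroup_mul A B.
Proof.
move=> x Bx; exists 1; first exact: subgroup1.
by exists x; rewrite ?mul1g.
Qed.

Lemma mul_sub (G : groupType) (A B : nsubgroup G) (C : subgroup G) :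
  A `<=` C -> B `<=` C -> nsubgroup_mul A B `<=` C.
Proof.
by move=> AC BC _ [a /AC Ca [b /BC Cb <-]]; apply: subgroupM.
Qed.

(** Links the elementwise product with the generated join, in which the sublattice condition is
    phrased. *)
Lemma nsubgroup_mulE (G : groupType) (A B : nsubgroup G) :
  nsubgroup_mul A B = subgroup_join A B :> subgroup G.
Proof.
apply: subgroup_inj; apply/seteqP; split.
  by apply: mul_sub => x ?; apply: sub_gen; [left|right].
by apply: gen_sub => x [|]; [apply: sub_mull|apply: sub_mulr].
Qed.

(** For fixed [y], the elements whose conjugate by [y] lies in [gen S] form a subgroup, and this
    subgroup contains [S]. *)
Lemma gen_is_normal (G : groupType) (S : set G) :
  (forall x y, S x -> S (x ^ y)) ->
  forall x y, subgroup_set (gen S) x -> subgroup_set (gen S) (x ^ y).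
Proof.
move=> nS x y Sx.
have SyP : is_subgroup [set z | subgroup_set (gen S) (z ^ y)].
  split=> [|a b|a] /=; first by rewrite conj1g; apply: (subgroup1 (gen S)).
    by rewrite conjMg; apply: (subgroupM (A := gen S)).
  by rewrite conjVg; apply: (subgroupV (A := gen S)).
have sub_SSy : gen S `<=` Subgroup SyP.
  by apply: gen_sub => z Sz /=; apply: sub_gen; apply: nS.
exact: sub_SSy Sx.
Qed.

Lemma image_is_subgroup (X Y : groupType) (f : {multiplicative X -> Y})
    (A : subgroup X) : is_subgroup (f @` A).
Proof.
split=> [|_ _ [x Ax <-] [y Ay <-]|_ [x Ax <-]].
- by exists 1; rewrite ?multiplicative1 //; apply: subgroup1.
- by exists (x * y); [apply: subgroupM|rewrite gmulfM].
- by exists x^-1; [apply: subgroupV|rewrite multiplicativeV].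
Qed.

Lemma image_normal (X Y : groupType) (f : {multiplicative X -> Y})
    (f_surj : forall y, exists x, f x = y) (A : nsubgroup X) x y :
  subgroup_set (Subgroup (image_is_subgroup f A)) x ->
  subgroup_set (Subgroup (image_is_subgroup f A)) (x ^ y).
Proof.
case: (f_surj y) => z <- [a Aa <-].
by exists (a ^ z); [apply: nsubgroupP|rewrite multiplicativeJ].
Qed.

Definition surj_image (X Y : groupType) (f : {multiplicative X -> Y})
    (f_surj : forall y, exists x, f x = y) (A : nsubgroup X) : nsubgroup Y :=
  NSubgroup (@image_normal X Y f f_surj A).

(** * Formations and Fitting classes *)

Lemma coradical_iso (C : group_class) (X Y : groupType) :
  is_coradical_class C -> isomorphic X Y -> C X -> C Y.
Proof. by case=> + _ _; apply. Qed.

(** Third isomorphism theorem: the composite projection from [G] onto the quotient of [G/A] by the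
    image of [B] has kernel [B]. *)
Lemma coradical_quotientS (C : group_class) (G : groupType) (A B : nsubgroup G) :
  is_coradical_class C -> A `<=` B ->
  C (quotient_group A) -> C (quotient_group B).
Proof.
move=> hC AB CA.
pose BA := surj_image (@quotient_proj_surj G A) B.
have : C (quotient_group BA) by case: hC => _ + _; apply.
apply: (coradical_iso hC); apply: isomorphic_sym.
apply: (@first_isomorphism _ _ _ (quotient_proj BA \o quotient_proj A)).
  move=> q; case: (quotient_proj_surj q) => y <-.
  by case: (quotient_proj_surj y) => x <-; exists x.
move=> x; rewrite /=; split.
  move=> /quotient_proj_eq1 [b Bb /quotient_proj_eq /AB Bbx].
  by rewrite -(mulVKg b x); apply: subgroupM.
by move=> Bx; apply/quotient_proj_eq1; exists x.
Qed.

(** The diagonal map of [G] into [G/A * G/B] has kernel the intersection of [A] and [B], and its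
    range is a subdirect product. *)
Lemma coradical_quotient_meet (C : group_class) (G : groupType)
    (A B : nsubgroup G) :
  is_coradical_class C -> C (quotient_group A) -> C (quotient_group B) ->
  C (quotient_group (nsubgroup_meet A B)).
Proof.
move=> hC CA CB.
pose d x := (quotient_proj A x, quotient_proj B x).
have dM : {morph d : x y / x * y} by move=> x y; rewrite /d !gmulfM.
pose d_mul := isMultiplicative.Build _ _ d dM.
pose f : {multiplicative G -> quotient_group A * quotient_group B} :=
  HB.pack d d_mul.
have SP : is_subgroup (range f).
  split=> [|_ _ [x _ <-] [y _ <-]|_ [x _ <-]].
  - by exists 1; rewrite ?multiplicative1.
  - by exists (x * y); rewrite ?gmulfM.
  - by exists x^-1; rewrite ?multiplicativeV.
pose S := Subgroup SP.
have : C (subgroup_group S).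
  case: hC => _ _; apply=> // [a|b].
    by case: (quotient_proj_surj a) => x <-; exists (quotient_proj B x), x.
  by case: (quotient_proj_surj b) => x <-; exists (quotient_proj A x), x.
apply: (coradical_iso hC); apply: isomorphic_sym.
have fS x : subgroup_set S (f x) by exists x.
apply: (@first_isomorphism _ _ _ (corestrict fS)).
  move=> y; case: (incl_mem y) => x _ fx.
  by exists x; apply: incl_inj; rewrite incl_corestrict.
move=> x; split.
  move=> /(congr1 (@incl _ _)); rewrite incl_corestrict multiplicative1 => -[/quotient_proj_eq1 ?].
  by move=> /quotient_proj_eq1.
case=> /quotient_proj_eq1 Ax /quotient_proj_eq1 Bx.
by apply: incl_inj; rewrite incl_corestrict multiplicative1 /f /= /d Ax Bx.
Qed.

Lemma radical_iso (C : group_class) (X Y : groupType) :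
  is_radical_class C -> isomorphic X Y -> C X -> C Y.
Proof. by case=> + _ _; apply. Qed.

(** The axioms of a radical class concern normal subgroups of a group in its own right, so a
    subgroup of [G] must be re-read inside the group [P]. *)
Definition rel_set (G : groupType) (P : subgroup G) (A : nsubgroup G) :
  set (subgroup_group P) := [set x | subgroup_set A (incl x)].

Lemma rel_is_subgroup (G : groupType) (P : subgroup G) (A : nsubgroup G) :
  is_subgroup (@rel_set G P A).
Proof.
rewrite /rel_set; split=> [|x y|x] /=.
- by rewrite multiplicative1; apply: subgroup1.
- by rewrite inclM; apply: subgroupM.
- by rewrite (multiplicativeV (@incl _ P)); apply: subgroupV.
Qed.

Lemma rel_normal (G : groupType) (P : subgroup G) (A : nsubgroup G) x y :
  subgroup_set (Subgroup (rel_is_subgroup P A)) x ->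
  subgroup_set (Subgroup (rel_is_subgroup P A)) (x ^ y).
Proof.
rewrite /= /rel_set /= (multiplicativeJ (@incl _ P)).
exact: nsubgroupP.
Qed.

Definition rel_nsubgroup (G : groupType) (P : subgroup G) (A : nsubgroup G) :
  nsubgroup (subgroup_group P) := NSubgroup (@rel_normal G P A).

Lemma rel_nsubgroup_isomorphic (G : groupType) (P : subgroup G)
    (A : nsubgroup G) : A `<=` P ->
  isomorphic (subgroup_group (rel_nsubgroup P A)) (subgroup_group A).
Proof.
move=> AP.
apply: (@subgroup_group_isomorphic _ _ (@incl _ P)).
  exact: incl_inj.
apply/seteqP; split=> [_ [x Ax <-] //|x Ax].
exists (in_subgroup (AP _ Ax)); last exact: incl_in_subgroup.
by rewrite /= /rel_set /= incl_in_subgroup.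
Qed.

Lemma radical_sub (C : group_class) (G : groupType) (A B : nsubgroup G) :
  is_radical_class C -> B `<=` A ->
  C (subgroup_group A) -> C (subgroup_group B).
Proof.
move=> hC BA CA; apply: (radical_iso hC (rel_nsubgroup_isomorphic BA)).
by case: hC => _ + _; apply.
Qed.

(** The product axiom is applied to the group [P = A B] itself, in which [A] and [B] have isomorphic
    copies as normal subgroups. *)
Lemma radical_mul (C : group_class) (G : groupType) (A B : nsubgroup G) :
  is_radical_class C -> C (subgroup_group A) -> C (subgroup_group B) ->
  C (subgroup_group (nsubgroup_mul A B)).
Proof.
move=> hC CA CB; pose P := nsubgroup_mul A B.
case: (hC) => _ _ /(_ (subgroup_group P) (rel_nsubgroup P A) (rel_nsubgroup P B)).
apply.
- apply: (radical_iso hC) CA; apply: isomorphic_sym.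
  exact/rel_nsubgroup_isomorphic/sub_mull.
- apply: (radical_iso hC) CB; apply: isomorphic_sym.
  exact/rel_nsubgroup_isomorphic/sub_mulr.
move=> x; case: (incl_mem x) => a Aa [b Bb abx].
exists (in_subgroup (sub_mull B Aa)).
  by rewrite /= /rel_set /= incl_in_subgroup.
exists (in_subgroup (sub_mulr A Bb)).
  by rewrite /= /rel_set /= incl_in_subgroup.
by apply: incl_inj; rewrite inclM !incl_in_subgroup.
Qed.

(** The index is that of the last term: [n] stands for [n + 1] factors, so no product or
    intersection is empty. The same shift governs the number of images in [aut_cover] and
    [min_cover]. *)
Fixpoint bigmul (G : groupType) (K : nat -> nsubgroup G) n : nsubgroup G :=
  if n is m.+1 then nsubgroup_mul (bigmul K m) (K n) else K 0.

Fixpoint bigmeet (G : groupType) (K : nat -> nsubgroup G) n : nsubgroup G :=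
  if n is m.+1 then nsubgroup_meet (bigmeet K m) (K n) else K 0.

Lemma bigmulS (G : groupType) (K : nat -> nsubgroup G) n :
  bigmul K n.+1 = nsubgroup_mul (bigmul K n) (K n.+1).
Proof. by []. Qed.

Lemma bigmul_sup (G : groupType) (K : nat -> nsubgroup G) n i :
  i <= n -> K i `<=` bigmul K n.
Proof.
elim: n => [|n IHn]; first by rewrite leqn0 => /eqP ->.
rewrite leq_eqVlt => /predU1P [->|]; first exact: sub_mulr.
by rewrite ltnS => /IHn; move/subset_trans; apply; apply: sub_mull.
Qed.

Lemma bigmul_sub (G : groupType) (K : nat -> nsubgroup G) (A : subgroup G) n :
  (forall i, i <= n -> K i `<=` A) -> bigmul K n `<=` A.
Proof.
elim: n => [|n IHn] KA; first exact: KA.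
by apply: mul_sub; [apply: IHn => i ?; apply/KA/leqW|apply: KA].
Qed.

Lemma bigmul_mono (G : groupType) (K L : nat -> nsubgroup G) n :
  (forall i, K i `<=` L i) -> bigmul K n `<=` bigmul L n.
Proof.
move=> KL; apply: bigmul_sub => i le_in.
exact: subset_trans (KL i) (bigmul_sup le_in).
Qed.

Lemma bigmeet_inf (G : groupType) (K : nat -> nsubgroup G) n i :
  i <= n -> bigmeet K n `<=` K i.
Proof.
elim: n => [|n IHn]; first by rewrite leqn0 => /eqP ->.
rewrite leq_eqVlt => /predU1P [-> x [] //|].
by rewrite ltnS => /IHn Ki x [/Ki].
Qed.

Lemma coradical_bigmeet (C : group_class) (G : groupType)
    (K : nat -> nsubgroup G) n :
  is_coradical_class C -> (forall i, C (quotient_group (K i))) ->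
  C (quotient_group (bigmeet K n)).
Proof. by move=> hC CK; elim: n => //= n; move/coradical_quotient_meet; apply. Qed.

Lemma radical_bigmul (C : group_class) (G : groupType)
    (K : nat -> nsubgroup G) n :
  is_radical_class C -> (forall i, i <= n -> C (subgroup_group (K i))) ->
  C (subgroup_group (bigmul K n)).
Proof.
move=> hC; elim: n => [|n IHn] CK; first exact: CK.
by apply: radical_mul => //; [apply: IHn => i ?; apply/CK/leqW|apply: CK].
Qed.

(** * Outer commutators of normal subgroups *)

Lemma commutator_normal (G : groupType) (A B : nsubgroup G) (x y : G) :
  let S := [set [~ a, b] | a in subgroup_set A & b in subgroup_set B] in
  subgroup_set (gen S) x -> subgroup_set (gen S) (x ^ y).
Proof.
apply: gen_is_normal => {}x {}y [a Aa [b Bb <-]].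
by exists (a ^ y); [|exists (b ^ y)]; rewrite ?conjRg //; apply: nsubgroupP.
Qed.

Definition commutator (G : groupType) (A B : nsubgroup G) : nsubgroup G :=
  NSubgroup (@commutator_normal G A B).

Lemma commutator_mem (G : groupType) (A B : nsubgroup G) a b :
  subgroup_set A a -> subgroup_set B b -> subgroup_set (commutator A B) [~ a, b].
Proof. by move=> Aa Bb; apply: sub_gen; exists a => //; exists b. Qed.

Lemma commutator_sub (G : groupType) (A B : nsubgroup G) (D : subgroup G) :
  (forall a b, subgroup_set A a -> subgroup_set B b -> subgroup_set D [~ a, b]) ->
  commutator A B `<=` D.
Proof. by move=> ABD; apply: gen_sub => _ [a Aa [b Bb <-]]; apply: ABD. Qed.


(** As [D] is normal, the identity [[x y, b] = [x, b]^y [y, b]] and its analogue for inverses make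
    the set of [x] with [[x, b]] in [D] a subgroup. *)
Lemma commgr_gen (G : groupType) (D : nsubgroup G) (S : set G) (b : G) :
  (forall a, S a -> subgroup_set D [~ a, b]) ->
  forall x, subgroup_set (gen S) x -> subgroup_set D [~ x, b].
Proof.
move=> SD.
have DP : is_subgroup [set x | subgroup_set D [~ x, b]].
  split=> [|x y Dx Dy|x Dx] /=.
  - by rewrite comm1g; apply: subgroup1.
  - have -> : [~ x * y, b] = [~ x, b] ^ y * [~ y, b].
      by rewrite !commgEl !conjgE !invgM !mulgA !mulgK.
    by apply: subgroupM => //; apply: nsubgroupP.
  - have -> : [~ x^-1, b] = [~ x, b]^-1 ^ x^-1.
      by rewrite !commgEl !conjgE !invgM !invgK !mulgA !mulgK.
    by apply: nsubgroupP; apply: subgroupV.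
have genS : gen S `<=` Subgroup DP by apply: gen_sub => a /SD.
by move=> x /genS.
Qed.

Lemma commgl_gen (G : groupType) (D : nsubgroup G) (S : set G) (a : G) :
  (forall b, S b -> subgroup_set D [~ a, b]) ->
  forall y, subgroup_set (gen S) y -> subgroup_set D [~ a, y].
Proof.
move=> SD y Sy; rewrite -invgR; apply: subgroupV.
by apply: commgr_gen Sy => b /SD; rewrite -invgR => /subgroupV; rewrite !invgR.
Qed.

Lemma commutator_mono (G : groupType) (A A' B B' : nsubgroup G) :
  A `<=` A' -> B `<=` B' -> commutator A B `<=` commutator A' B'.
Proof.
move=> sA sB; apply: commutator_sub => a b /sA Aa /sB Bb.
exact: commutator_mem.
Qed.

Lemma commutatorC (G : groupType) (A B : nsubgroup G) :
  commutator A B = commutator B A.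
Proof.
apply: nsubgroup_inj; wlog suff sAB : A B / commutator A B `<=` commutator B A.
  by apply/seteqP; split; apply: sAB.
apply: commutator_sub => a b Aa Bb; rewrite -invgR.
by apply: subgroupV; apply: commutator_mem.
Qed.

(** The right-hand side is normal and [A B] is generated by the union of [A] and [B], so it is
    enough to treat first entries in [A] or in [B]. *)
Lemma commutator_mull (G : groupType) (A B D : nsubgroup G) :
  commutator (nsubgroup_mul A B) D `<=`
  nsubgroup_mul (commutator A D) (commutator B D).
Proof.
apply: commutator_sub => x d ABx Dd.
have ABE : subgroup_set (gen (A `|` B)) x.
  by have := ABx; rewrite (nsubgroup_mulE A B).
apply: commgr_gen ABE => a [Aa|Ba].
  by apply: sub_mull; apply: commutator_mem.
by apply: sub_mulr; apply: commutator_mem.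
Qed.

Lemma commutator_bigmull (G : groupType) (K : nat -> nsubgroup G)
    (D : nsubgroup G) n :
  commutator (bigmul K n) D `<=` bigmul (fun j => commutator (K j) D) n.
Proof.
elim: n => [//|n IHn]; rewrite !bigmulS.
apply: subset_trans (@commutator_mull _ _ _ _) _.
apply: mul_sub; last exact: sub_mulr.
exact: subset_trans IHn (@sub_mull _ _ _).
Qed.

Lemma commutator_bigmulr (G : groupType) (K : nat -> nsubgroup G)
    (D : nsubgroup G) n :
  commutator D (bigmul K n) `<=` bigmul (fun j => commutator D (K j)) n.
Proof.
rewrite commutatorC; under eq_fun do rewrite commutatorC.
exact: commutator_bigmull.
Qed.

Lemma commutator_aut (G : groupType) (phi : aut G) (A B : nsubgroup G) :
  commutator (aut_nimage phi A) (aut_nimage phi B) `<=`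
  aut_nimage phi (commutator A B).
Proof.
apply: commutator_sub => _ _ [a Aa <-] [b Bb <-].
by exists [~ a, b]; [apply: commutator_mem|rewrite multiplicativeR].
Qed.

(** The iterated commutator subgroup, as opposed to the subgroup generated by the values of [w]; its
    recursive form suits induction on [w]. *)
Fixpoint oc_nsubgroup (G : groupType) t (w : outer_comm t) :
    ('I_t -> nsubgroup G) -> nsubgroup G :=
  match w in outer_comm t0 return ('I_t0 -> nsubgroup G) -> nsubgroup G with
  | oc_letter => fun K => K ord0
  | oc_comm r s u v => fun K =>
      commutator (oc_nsubgroup u (fun i => K (lshift s i)))
                 (oc_nsubgroup v (fun i => K (rshift r i)))
  end.

Lemma oc_eval_mem (G : groupType) t (w : outer_comm t) (K : 'I_t -> nsubgroup G)
    (h : 'I_t -> G) :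
  (forall i, subgroup_set (K i) (h i)) ->
  subgroup_set (oc_nsubgroup w K) (oc_eval w h).
Proof.
elim: w K h => [|r s u IHu v IHv] K h Kh /=; first exact: Kh.
by apply: commutator_mem; [apply: IHu|apply: IHv].
Qed.

Lemma oc_evalJ (G : groupType) t (w : outer_comm t) (h : 'I_t -> G) y :
  oc_eval w h ^ y = oc_eval w (fun i => h i ^ y).
Proof. by elim: w h => [//|r s u IHu v IHv] h /=; rewrite conjRg IHu IHv. Qed.

Lemma oc_subgroup_normal (G : groupType) t (w : outer_comm t)
    (K : 'I_t -> nsubgroup G) x y :
  subgroup_set (oc_subgroup w K) x -> subgroup_set (oc_subgroup w K) (x ^ y).
Proof.
apply: gen_is_normal => _ {}y [h Kh <-]; rewrite oc_evalJ.
by exists (fun i => h i ^ y) => // i; apply: nsubgroupP; apply: Kh.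
Qed.

(** By induction both entries of the outer commutator are generated by values of [u] and of [v].
    Reduction to generators on each side leaves commutators of two values, which are values of [w]
    because [u] and [v] share no letter. *)
Lemma oc_subgroupE (G : groupType) t (w : outer_comm t)
    (K : 'I_t -> nsubgroup G) : oc_subgroup w K = oc_nsubgroup w K.
Proof.
apply: subgroup_inj; apply/seteqP; split.
  by apply: gen_sub => _ [h Kh <-]; apply: oc_eval_mem.
elim: w K => [|r s u IHu v IHv] K /=.
  by move=> x Kx; apply: sub_gen; exists (fun=> x) => // i; rewrite ord1.
(* The reduction to generators requires a normal target. *)
pose D := NSubgroup (@oc_subgroup_normal G _ (oc_comm u v) K).
change (commutator (oc_nsubgroup u (fun i => K (lshift s i)))
                   (oc_nsubgroup v (fun i => K (rshift r i))) `<=` D).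
apply: commutator_sub => a b /IHu ua /IHv vb.
apply: commgr_gen ua => _ [h Kh <-]; apply: commgl_gen vb => _ [k Kk <-].
apply: sub_gen.
(* The arguments of [u] and of [v] are concatenated. *)
exists (fun i => match split i with inl j => h j | inr j => k j end).
  move=> i /=; case: splitP => j ij.
    by rewrite (_ : i = lshift s j); [apply: Kh|apply: val_inj].
  by rewrite (_ : i = rshift r j); [apply: Kk|apply: val_inj].
congr [~ _, _]; congr oc_eval; apply/funext => i.
  by rewrite (unsplitK (inl i)).
by rewrite (unsplitK (inr i)).
Qed.

Lemma oc_nsubgroup_mono (G : groupType) t (w : outer_comm t)
    (K L : 'I_t -> nsubgroup G) :
  (forall i, K i `<=` L i) -> oc_nsubgroup w K `<=` oc_nsubgroup w L.
Proof.
elim: w K L => [|r s u IHu v IHv] K L KL /=; first exact: KL.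
by apply: commutator_mono; [apply: IHu|apply: IHv].
Qed.

Lemma oc_nsubgroup_aut (G : groupType) (phi : aut G) t (w : outer_comm t)
    (K : 'I_t -> nsubgroup G) :
  oc_nsubgroup w (fun i => aut_nimage phi (K i)) `<=`
  aut_nimage phi (oc_nsubgroup w K).
Proof.
elim: w K => [|r s u IHu v IHv] K //=.
apply: subset_trans (@commutator_aut _ _ _ _).
by apply: commutator_mono; [apply: IHu|apply: IHv].
Qed.

(** Multilinearity in the coordinate [i0]: it occurs in only one of [u] and [v], where induction
    applies, and the outer commutator then distributes over the resulting product. *)
Lemma oc_nsubgroup_bigmul (G : groupType) t (w : outer_comm t)
    (K : 'I_t -> nsubgroup G) (i0 : 'I_t) (L : nat -> nsubgroup G) n :
  K i0 `<=` bigmul L n ->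
  oc_nsubgroup w K `<=`
  bigmul (fun j => oc_nsubgroup w (fun i => if i == i0 then L j else K i)) n.
Proof.
elim: w K i0 => [|r s u IHu v IHv] K i0 KL.
  rewrite /= ord1 in KL *; apply: subset_trans KL _; apply: bigmul_mono => j.
  by rewrite eqxx.
case: (split_ordP i0) KL => j -> KL /=.
  apply: subset_trans (commutator_mono (IHu _ j KL) (@subset_refl _ _)) _.
  apply: subset_trans (@commutator_bigmull _ _ _ _) _; apply: bigmul_mono => m.
  apply: commutator_mono; apply: oc_nsubgroup_mono => i; first by rewrite eq_lshift.
  by rewrite eq_rlshift.
apply: subset_trans (commutator_mono (@subset_refl _ _) (IHv _ j KL)) _.
apply: subset_trans (@commutator_bigmulr _ _ _ _) _; apply: bigmul_mono => m.
apply: commutator_mono; apply: oc_nsubgroup_mono => i; last by rewrite eq_rshift.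
by rewrite eq_lrshift.
Qed.

(** * Chain conditions and products of automorphic images *)

Lemma id_bij (T : Type) : bijective (@idfun T).
Proof. by exists idfun. Qed.

Definition aut_id (G : groupType) : aut G :=
  @Aut G (idfun : {multiplicative G -> G}) (id_bij G).

Definition aut_comp (G : groupType) (phi psi : aut G) : aut G :=
  @Aut G (phi \o psi : {multiplicative G -> G})
    (bij_comp (aut_bij phi) (aut_bij psi)).

Lemma aut_inv (G : groupType) (phi : aut G) :
  exists2 psi : aut G, cancel phi psi & cancel psi phi.
Proof.
case: (aut_bij phi) => g phiK gK.
pose g_mul := isMultiplicative.Build G G g (can2_gmulfM phiK gK).
by exists (@Aut G (HB.pack g g_mul : {multiplicative G -> G}) (Bijective gK phiK)).
Qed.

Lemma aut_inj (G : groupType) (phi : aut G) : injective phi.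
Proof. by case: (aut_inv phi) => psi /can_inj. Qed.

Lemma aut_nimage_id (G : groupType) (M : nsubgroup G) :
  aut_nimage (aut_id G) M = M.
Proof. by apply: nsubgroup_inj; apply: image_id. Qed.

Lemma aut_nimage_comp (G : groupType) (phi psi : aut G) (M : nsubgroup G) :
  aut_nimage phi (aut_nimage psi M) = aut_nimage (aut_comp phi psi) M.
Proof. by apply: nsubgroup_inj; rewrite /= image_comp. Qed.

Lemma aut_nimage_mono (G : groupType) (phi : aut G) (A B : nsubgroup G) :
  A `<=` B -> aut_nimage phi A `<=` aut_nimage phi B.
Proof. exact: image_subset. Qed.

Lemma aut_nimage_meet (G : groupType) (phi : aut G) (A B : nsubgroup G) :
  aut_nimage phi (nsubgroup_meet A B) =
  nsubgroup_meet (aut_nimage phi A) (aut_nimage phi B).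
Proof.
apply: nsubgroup_inj; apply/seteqP; split=> [_ [x [Ax Bx] <-]|_ [[x Ax <-]]].
  by split; exists x.
by case=> y By /aut_inj yx; exists x => //; split=> //; rewrite -yx.
Qed.

Lemma aut_nimage_bigmeet (G : groupType) (phi : aut G) (K : nat -> nsubgroup G) n :
  aut_nimage phi (bigmeet K n) = bigmeet (fun i => aut_nimage phi (K i)) n.
Proof. by elim: n => //= n <-; apply: aut_nimage_meet. Qed.

Lemma aut_nimage_bigmul (G : groupType) (phi : aut G) (K : nat -> nsubgroup G) n :
  aut_nimage phi (bigmul K n) `<=` bigmul (fun i => aut_nimage phi (K i)) n.
Proof.
elim: n => [//|n IHn]; rewrite !bigmulS => _ [_ [x Kx [y Ky <-]] <-].
rewrite gmulfM; exists (phi x); first by apply: IHn; exists x.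
by exists (phi y) => //; exists y.
Qed.

Lemma aut_image_isomorphic (G : groupType) (phi : aut G) (A : subgroup G) :
  isomorphic (subgroup_group A) (subgroup_group (aut_image phi A)).
Proof. by apply: (@subgroup_group_isomorphic _ _ phi) => //; apply: aut_inj. Qed.

Lemma aut_quotient_isomorphic (G : groupType) (phi : aut G) (M : nsubgroup G) :
  isomorphic (quotient_group M) (quotient_group (aut_nimage phi M)).
Proof.
apply: (@first_isomorphism _ _ _ (quotient_proj (aut_nimage phi M) \o phi)).
  move=> q; case: (quotient_proj_surj q) (aut_inv phi) => y <- [psi _ psiK].
  by exists (psi y); rewrite /= psiK.
move=> x; rewrite /=; split; last first.
  by move=> Mx; apply/quotient_proj_eq1; exists x.
by move=> /quotient_proj_eq1 [y My /aut_inj <-].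
Qed.

(** The chain condition of [G/M] expressed inside [G], where it can be compared for different
    subgroups [M]. *)
Definition max_normal_above (G : groupType) (M : nsubgroup G) : Prop :=
  forall K : nat -> nsubgroup G, M `<=` K 0 -> (forall i, K i `<=` K i.+1) ->
    exists n, forall m, n <= m -> K m = K n :> set G.

Lemma chain_sub (G : groupType) (K : nat -> nsubgroup G) :
  (forall i, K i `<=` K i.+1) -> forall i j, i <= j -> K i `<=` K j.
Proof.
move=> KS i j /subnK <-; elim: (j - i) => // d IHd.
exact: subset_trans IHd (KS _).
Qed.

Lemma max_normal_above_quotient (G : groupType) (M : nsubgroup G) :
  max_normal (quotient_group M) -> max_normal_above M.
Proof.
move=> maxM K MK KS.
case: (maxM (fun i => surj_image (@quotient_proj_surj G M) (K i))).
  by move=> i; apply: image_subset.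
move=> n Kn; exists n => m le_nm; apply/seteqP; split; last exact: chain_sub.
move=> x Kx.
have : subgroup_set (surj_image (@quotient_proj_surj G M) (K n))
    (quotient_proj M x).
  by have <- := Kn _ le_nm; exists x.
(* Some [y] in [K n] has the same coset as [x], and [y^-1 x] lies in [M], hence in [K 0] and in
   [K n]. *)
case=> y Ky /quotient_proj_eq /MK /(chain_sub KS (leq0n n)) Kyx.
by rewrite -(mulVKg y x); apply: subgroupM.
Qed.

Lemma max_normal_above_aut (G : groupType) (phi : aut G) (M : nsubgroup G) :
  max_normal_above M -> max_normal_above (aut_nimage phi M).
Proof.
move=> maxM K MK KS; case: (aut_inv phi) => psi phiK psiK.
case: (maxM (fun i => aut_nimage psi (K i))) => [x Mx|i|n Kn].
- by exists (phi x); [apply: MK; exists x|apply: phiK].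
- exact: aut_nimage_mono.
exists n => m /Kn /= eqK.
have imK (A : set G) : phi @` (psi @` A) = A.
  rewrite image_comp (_ : phi \o psi = id) ?image_id //.
  by apply/funext => x /=; apply: psiK.
by rewrite -(imK (K m)) eqK imK.
Qed.

(* A chain [K_i] above [A `&` B] is determined by the chains [K_i A] and
   [K_i `&` A]; by the modular law the latter is recovered from
   [(K_i `&` A) B]. *)
Lemma max_normal_above_meet (G : groupType) (A B : nsubgroup G) :
  max_normal_above A -> max_normal_above B ->
  max_normal_above (nsubgroup_meet A B).
Proof.
move=> maxA maxB K ABK KS.
have [|i|n1 Kn1] := maxA (fun i => nsubgroup_mul (K i) A).
- exact: sub_mulr.
- apply: mul_sub; last exact: sub_mulr.
  exact: subset_trans (KS i) (@sub_mull _ _ _).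
have [|i|n2 Kn2] := maxB (fun i => nsubgroup_mul (nsubgroup_meet (K i) A) B).
- exact: sub_mulr.
- apply: mul_sub; last exact: sub_mulr.
  by apply: subset_trans (@sub_mull _ _ _) => x [/KS].
exists (maxn n1 n2) => m; rewrite geq_max => /andP[le1 le2].
apply/seteqP; split; last by apply: chain_sub => //; rewrite geq_max le1.
set n := maxn n1 n2.
(* Writing [y = c b] with [c] in both [K n2] and [A], and [b] in [B], the element [b = c^-1 y] also
   lies in [A], hence in [K 0]. *)
have KAB i y : subgroup_set (K i) y -> subgroup_set A y -> n2 <= i ->
    subgroup_set (K n2) y.
  move=> Ky Ay le_i.
  have : subgroup_set (nsubgroup_mul (nsubgroup_meet (K i) A) B) y.
    by apply: sub_mull.
  have -> := Kn2 _ le_i; case=> c [Kc Ac] [b Bb cby].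
  rewrite -cby; apply: subgroupM => //.
  apply: (chain_sub KS (leq0n _)); apply: ABK; split=> //.
  by rewrite -(mulKg c b) cby; apply: subgroupM => //; apply: subgroupV.
move=> x Kx; have : subgroup_set (nsubgroup_mul (K m) A) x by apply: sub_mull.
have -> := Kn1 _ le1; case=> k Kk [a Aa kax].
have Kma : subgroup_set (K m) a.
  rewrite -(mulKg k a) kax; apply: subgroupM => //; apply: subgroupV.
  exact: chain_sub Kk.
rewrite -kax; apply: subgroupM.
  by apply: (chain_sub KS) Kk; rewrite leq_maxl.
by apply: (chain_sub KS) (KAB _ _ Kma Aa le2); rewrite leq_maxr.
Qed.

(** * Finite covers by automorphic images, hulls and cores *)

Definition aut_cover (G : groupType) (M : nsubgroup G) (psi : nat -> aut G) n :=
  forall phi : aut G, aut_nimage phi M `<=` bigmul (fun i => aut_nimage (psi i) M) n.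

Lemma aut_cover_exists (G : groupType) (M : nsubgroup G) :
  max_normal_above M -> exists psi n, aut_cover M psi n.
Proof.
move=> maxM.
(* [xi K] selects an image of [M] not contained in [K] whenever there is one. *)
have /choice[xi xiP] : forall K : nsubgroup G, exists phi0 : aut G,
    aut_nimage phi0 M `<=` K -> forall phi : aut G, aut_nimage phi M `<=` K.
  move=> K; case: (pselect (forall phi : aut G, aut_nimage phi M `<=` K)).
    by move=> sMK; exists (aut_id G).
  by move/existsNP => [phi nphi]; exists phi => /nphi.
pose K := fix K n := if n is m.+1
  then nsubgroup_mul (K m) (aut_nimage (xi (K m)) M) else M.
pose psi n := if n is m.+1 then xi (K m) else aut_id G.
have KE n : K n = bigmul (fun i => aut_nimage (psi i) M) n.
  by elim: n => [|n IHn] /=; rewrite ?aut_nimage_id // -IHn.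
have [//|i|n Kn] := maxM K; first exact: sub_mull.
(* Once the greedy chain is stationary, the image selected for [K n] is already inside [K n], so
   every image is. *)
exists psi, n => phi; rewrite -KE; apply: xiP.
have <- := Kn _ (leqnSn n); exact: sub_mulr.
Qed.

Definition min_aut_cover (G : groupType) (M : nsubgroup G)
    (p : (nat -> aut G) * nat) : Prop :=
  aut_cover M p.1 p.2 /\ forall psi n, aut_cover M psi n -> p.2 <= n.

Lemma min_aut_cover_exists (G : groupType) (M : nsubgroup G) :
  max_normal_above M -> exists p, min_aut_cover M p.
Proof.
move=> /aut_cover_exists[psi [n Mn]].
have ex_n : exists n, `[< exists psi, aut_cover M psi n >].
  by exists n; apply/asboolP; exists psi.
case: (ex_minnP ex_n) => m /asboolP[psi' Mm] min_m; exists (psi', m).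
by split=> // psi2 k Mk; apply: min_m; apply/asboolP; exists psi2.
Qed.

(** A choice with a default value, so that hull and core are total functions and the core can be
    iterated; under the chain condition a minimal cover exists and is the value taken. *)
Definition min_cover (G : groupType) (M : nsubgroup G) : (nat -> aut G) * nat :=
  if pselect (exists p, min_aut_cover M p) is left ex_p
  then projT1 (cid ex_p) else (fun=> aut_id G, 0).

Lemma min_coverP (G : groupType) (M : nsubgroup G) :
  max_normal_above M -> min_aut_cover M (min_cover M).
Proof.
move=> /min_aut_cover_exists ex_p; rewrite /min_cover.
by case: pselect => // ex_p'; case: cid.
Qed.

Definition aut_hull (G : groupType) (M : nsubgroup G) : nsubgroup G :=
  bigmul (fun i => aut_nimage ((min_cover M).1 i) M) (min_cover M).2.

(** This depends on the chosen cover and need not be characteristic, which is why each [H_t] is a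
    hull. *)
Definition aut_core (G : groupType) (M : nsubgroup G) : nsubgroup G :=
  bigmeet (fun i => aut_nimage ((min_cover M).1 i) M) (min_cover M).2.

Lemma sub_aut_hull (G : groupType) (M : nsubgroup G) (phi : aut G) :
  max_normal_above M -> aut_nimage phi M `<=` aut_hull M.
Proof. by move=> /min_coverP[] /(_ phi). Qed.

Lemma sub_aut_hull_id (G : groupType) (M : nsubgroup G) :
  max_normal_above M -> M `<=` aut_hull M.
Proof. by rewrite -{2}(aut_nimage_id M); apply: sub_aut_hull. Qed.

(** An automorphism carries each factor of the hull to another image of [M], and the hull contains
    all of these. *)
Lemma aut_hull_stable (G : groupType) (M : nsubgroup G) (phi : aut G) :
  max_normal_above M -> aut_nimage phi (aut_hull M) `<=` aut_hull M.
Proof.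
move=> maxM; apply: subset_trans (@aut_nimage_bigmul _ _ _ _) _.
by apply: bigmul_sub => i _; rewrite aut_nimage_comp; apply: sub_aut_hull.
Qed.

Lemma aut_hull_sub_image (G : groupType) (M : nsubgroup G) (phi : aut G) :
  max_normal_above M -> aut_hull M `<=` aut_nimage phi (aut_hull M).
Proof.
move=> maxM x Mx; case: (aut_inv phi) => psi _ psiK.
by exists (psi x) => //; apply: (@aut_hull_stable _ _ psi) => //; exists x.
Qed.

Lemma aut_hull_characteristic (G : groupType) (M : nsubgroup G) :
  max_normal_above M -> is_characteristic (aut_hull M).
Proof.
move=> maxM phi; apply/seteqP; split; first exact: aut_hull_stable.
exact: aut_hull_sub_image.
Qed.

(** The core lies in the first image of the cover, so each image of the core lies in an image of
    [M]. *)
Lemma aut_hull_core (G : groupType) (M : nsubgroup G) :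
  max_normal_above M -> aut_hull (aut_core M) `<=` aut_hull M.
Proof.
move=> maxM; apply: bigmul_sub => i _.
have core0 : aut_core M `<=` aut_nimage ((min_cover M).1 0) M.
  exact: (@bigmeet_inf _ _ _ 0).
apply: subset_trans (aut_nimage_mono core0) _.
by rewrite aut_nimage_comp; apply: sub_aut_hull.
Qed.

Lemma max_normal_above_core (G : groupType) (M : nsubgroup G) :
  max_normal_above M -> max_normal_above (aut_core M).
Proof.
move=> maxM; rewrite /aut_core; elim: (min_cover M).2 => [|n IHn] /=.
  exact: max_normal_above_aut.
by apply: max_normal_above_meet => //; apply: max_normal_above_aut.
Qed.

(** Indexed from 0: [core_seq N n] is the [N_(n+1)] of the overview, and [H_t] is the hull of
    [core_seq N t.-1]. *)
Definition core_seq (G : groupType) (N : nsubgroup G) n : nsubgroup G :=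
  iter n (@aut_core G) N.

Lemma max_normal_above_core_seq (G : groupType) (N : nsubgroup G) n :
  max_normal_above N -> max_normal_above (core_seq N n).
Proof. by move=> maxN; elim: n => //= n; apply: max_normal_above_core. Qed.

(** For [n = 0] the truncated predecessor makes both sides equal; this form matches the condition on
    untreated coordinates in the induction below. *)
Lemma aut_hull_core_seq (G : groupType) (N : nsubgroup G) n :
  max_normal_above N ->
  aut_hull (core_seq N n) `<=` aut_hull (core_seq N n.-1).
Proof.
by move=> maxN; case: n => //= n; apply/aut_hull_core/max_normal_above_core_seq.
Qed.

(** * The commutator subgroups of the hulls *)

(* Coordinates are processed from left to right.  After [k - n] steps those
   already treated lie in one image [chi] of the [n]-th core and the others in
   the previous hull; the next one, lying in a finite product of images of the
   core, is split off by multilinearity, and the definition of the core as an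
   intersection puts the coordinates treated earlier in each of the factors. *)
Lemma radical_oc_nsubgroup_step (G : groupType) (N : nsubgroup G)
    (C : group_class) k (w : outer_comm k) n (chi : aut G)
    (K : 'I_k -> nsubgroup G) :
  max_normal_above N -> is_radical_class C ->
  C (subgroup_group (oc_nsubgroup w (fun=> N))) -> n <= k ->
  (forall i : 'I_k, i < k - n -> K i `<=` aut_nimage chi (core_seq N n)) ->
  (forall i : 'I_k, k - n <= i -> K i `<=` aut_hull (core_seq N n.-1)) ->
  C (subgroup_group (oc_nsubgroup w K)).
Proof.
move=> maxN hC CN; elim: n chi K => [|n IHn] chi K le_nk Kcore Khull.
  (* All coordinates are treated, so the subgroup lies in the image under [chi] of [w(N, ..., N)],
     an isomorphic copy of that group. *)
  apply: (radical_sub (A := aut_nimage chi (oc_nsubgroup w (fun=> N)))) => //.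
    apply: subset_trans (@oc_nsubgroup_aut _ _ _ _ _).
    by apply: oc_nsubgroup_mono => i; apply: Kcore; rewrite subn0.
  exact: radical_iso (aut_image_isomorphic chi _) CN.
have i0P : k - n.+1 < k by rewrite ltn_subrL /=; apply: leq_ltn_trans le_nk.
pose i0 := Ordinal i0P.
have maxM := max_normal_above_core_seq (n := n) maxN.
set M := core_seq N n in maxM.
(* The cover is translated by [chi], so that every [L j] in the cover contains the image under [chi]
   of the next core. The translates still multiply up to the hull, since the hull is
   characteristic. *)
pose L j := aut_nimage (aut_comp chi ((min_cover M).1 j)) M.
have KL : K i0 `<=` bigmul L (min_cover M).2.
  apply: subset_trans (Khull i0 (leqnn _)) _.
  have hullS : aut_hull M `<=` aut_nimage chi (aut_hull M).
    exact: aut_hull_sub_image.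
  apply: subset_trans hullS _.
  apply: subset_trans (@aut_nimage_bigmul _ _ _ _) _.
  by apply: bigmul_mono => j; rewrite aut_nimage_comp.
apply: (radical_sub hC (oc_nsubgroup_bigmul (w := w) KL)).
apply: radical_bigmul => // j le_j.
apply: (IHn (aut_comp chi ((min_cover M).1 j))) => [|i lt_i|i le_i].
- exact: ltnW.
- case: eqP => [_|/eqP ne_i]; first exact: subset_refl.
  have lt_i0 : i < k - n.+1.
    by rewrite ltn_neqAle ne_i -ltnS -subSn.
  apply: subset_trans (Kcore i lt_i0) _; rewrite -aut_nimage_comp.
  by apply: aut_nimage_mono; apply: bigmeet_inf.
- have lt_i0 : k - n.+1 < i by apply: leq_trans le_i; rewrite ltn_sub2l.
  rewrite ifN; last by rewrite -val_eqE /= gtn_eqF.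
  apply: subset_trans (Khull i (ltnW lt_i0)) _; exact: aut_hull_core_seq.
Qed.

Lemma aut_hull_core_seq_le (G : groupType) (N : nsubgroup G) m n :
  max_normal_above N -> m <= n ->
  aut_hull (core_seq N n) `<=` aut_hull (core_seq N m).
Proof.
move=> maxN /subnK <-; elim: (n - m) => // d IHd.
rewrite addSn; exact: subset_trans (aut_hull_core_seq (n := (d + m).+1) maxN) IHd.
Qed.

Lemma radical_oc_aut_hull (G : groupType) (N : nsubgroup G) t k
    (w : outer_comm k) :
  max_normal_above N -> k <= t ->
  radical_class_gen (subgroup_group (oc_subgroup w (fun=> N)))
    (subgroup_group (oc_subgroup w (fun=> aut_hull (core_seq N t.-1)))).
Proof.
move=> maxN le_kt C hC; rewrite !oc_subgroupE => CN.
(* With [n = k] no coordinate has been treated yet, and only the condition on the hull remains. *)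
apply: (radical_oc_nsubgroup_step (n := k) (chi := aut_id G)) CN _ _ _ => //.
  by move=> i; rewrite subnn.
move=> i _; apply: aut_hull_core_seq_le => //.
by case: k t le_kt {w i} => [|k] [|t].
Qed.

(** * Membership in the formation and in the sublattice *)

Lemma coradical_core_seq (C : group_class) (G : groupType) (N : nsubgroup G) n :
  is_coradical_class C -> C (quotient_group N) ->
  C (quotient_group (core_seq N n)).
Proof.
move=> hC CN; elim: n => //= n IHn; apply: coradical_bigmeet => // i.
exact: coradical_iso (aut_quotient_isomorphic _ _) IHn.
Qed.

Lemma coradical_aut_hull (C : group_class) (G : groupType) (M : nsubgroup G) :
  is_coradical_class C -> max_normal_above M -> C (quotient_group M) ->
  C (quotient_group (aut_hull M)).
Proof.
move=> hC maxM; apply: coradical_quotientS => //; exact: sub_aut_hull_id.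
Qed.

Lemma sublattice_bigmul (G : groupType) (S : set (subgroup G))
    (K : nat -> nsubgroup G) n :
  (forall i, in_sublattice_gen S (K i)) -> in_sublattice_gen S (bigmul K n).
Proof.
move=> KS; elim: n => [|n IHn]; first exact: KS.
move=> L SL LM LJ; rewrite bigmulS nsubgroup_mulE.
by apply: (LJ); [apply: IHn|apply: KS].
Qed.

Lemma sublattice_bigmeet (G : groupType) (S : set (subgroup G))
    (K : nat -> nsubgroup G) n :
  (forall i, in_sublattice_gen S (K i)) -> in_sublattice_gen S (bigmeet K n).
Proof.
move=> KS; elim: n => [|n IHn]; first exact: KS.
move=> L SL LM LJ.
by apply: (LM); [apply: IHn|apply: KS].
Qed.

(** The automorphism is part of the induction: an image of the next core is an intersection of
    images of the present one. *)
Lemma sublattice_core_seq (G : groupType) (N : nsubgroup G) n (phi : aut G) :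
  in_sublattice_gen [set aut_image phi N | phi in [set: aut G]]
    (aut_nimage phi (core_seq N n)).
Proof.
elim: n phi => [|n IHn] phi; first by move=> L SL _ _; apply: SL; exists phi.
rewrite /core_seq iterS -/(core_seq N n) /aut_core aut_nimage_bigmeet.
apply: sublattice_bigmeet => i.
by rewrite aut_nimage_comp; apply: IHn.
Qed.

(** * Codimensions *)

Lemma prod_sub_bigmul (G : groupType) (K : nat -> nsubgroup G) n :
  nsubgroup_prod (fun i : 'I_n.+1 => K i) `<=` bigmul K n.
Proof.
move=> _ [x Kx <-]; apply: (big_ind (subgroup_set (bigmul K n))) => [|a b|i _].
- exact: subgroup1.
- exact: subgroupM.
- by apply: (bigmul_sup (i := i)); [rewrite -ltnS|apply: Kx].
Qed.

Local Open Scope ring_scope.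

(** Condition (3) with both subgroups equal to [M] says that [codim M] is at most its double. *)
Lemma codim_ge0 (R : realType) (G : groupType) (L : set (nsubgroup G))
    (codim : nsubgroup G -> R) M :
  is_gen_codim L codim -> L M -> 0 <= codim M.
Proof.
move=> cd LM; have := codim_meet cd LM LM.
have -> : nsubgroup_meet M M = M by apply: nsubgroup_inj; apply: setIid.
by rewrite lerDl.
Qed.

Lemma codim_bigmeet (R : realType) (G : groupType) (L : set (nsubgroup G))
    (codim : nsubgroup G -> R) (K : nat -> nsubgroup G) (c : R) n :
  is_gen_codim L codim ->
  (forall A B, L A -> L B -> L (nsubgroup_meet A B)) ->
  (forall i, L (K i)) -> (forall i, codim (K i) <= c) ->
  L (bigmeet K n) /\ codim (bigmeet K n) <= n.+1%:R * c.
Proof.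
move=> cd LI LK Kc; elim: n => [|n [Ln IHn]] /=; first by rewrite mul1r.
split; first exact: LI.
apply: le_trans (codim_meet cd Ln (LK _)) _.
by rewrite -natr1 mulrDl mul1r lerD.
Qed.

(** By (2) the codimension is at most [codim M] on all images of [M], so (4) yields a cover by at
    most [codim M + 1] of them; a minimal cover has no more factors. *)
Lemma min_cover_le (R : realType) (G : groupType) (L : set (nsubgroup G))
    (codim : nsubgroup G -> R) (M : nsubgroup G) :
  is_gen_codim L codim -> max_normal_above M ->
  L M -> (forall phi : aut G, L (aut_nimage phi M)) ->
  (min_cover M).2.+1%:R <= codim M + 1.
Proof.
move=> cd maxM LM Laut; pose F := [set aut_nimage phi M | phi in [set: aut G]].
have F0 : F !=set0 by exists (aut_nimage (aut_id G) M), (aut_id G).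
have FM : ubound (codim @` F) (codim M).
  by move=> _ [_ [phi _ <-] <-]; apply: (codim_aut cd).
have FL : F `<=` L by move=> _ [phi _ <-].
have [|r [K [r_gt0 le_r FK genF]]] := codim_join cd FL F0.
  by exists (codim M).
have /choice[psi psiK] : forall i, exists phi : aut G, aut_nimage phi M = K i.
  by move=> i; case: (FK i) => phi _ <-; exists phi.
have le_rM : r%:R <= codim M + 1.
  apply: le_trans le_r _; rewrite lerD2r; apply: ge_sup => //.
  exact: image_nonempty.
case: r r_gt0 => // r _ in K le_r FK genF psi psiK le_rM *.
apply: le_trans le_rM; rewrite ler_nat ltnS.
(* [inord] extends the finite family given by (4) to all of [nat]; only the indices up to [r] enter
   the product. *)
case: (min_coverP maxM) => _ /(_ (fun j => psi (inord j))); apply => phi.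
have genFE : gen (\bigcup_(A in F) (A : set G)) `<=`
    bigmul (fun j => aut_nimage (psi (inord j)) M) r.
  rewrite genF; apply: subset_trans (@prod_sub_bigmul _ _ _).
  have -> : (fun i : 'I_r.+1 => aut_nimage (psi (inord i)) M) = K.
    by apply/funext => i; rewrite inord_val psiK.
  exact: subset_refl.
apply: subset_trans genFE => x phix; apply: sub_gen.
by exists (aut_nimage phi M) => //; exists phi.
Qed.

Lemma codim_core_seq (R : realType) (G : groupType) (L : set (nsubgroup G))
    (codim : nsubgroup G -> R) (N : nsubgroup G) n :
  is_gen_codim L codim -> max_normal_above N ->
  (forall A B, L A -> L B -> L (nsubgroup_meet A B)) ->
  (forall (phi : aut G) A, L A -> L (aut_nimage phi A)) -> L N ->
  L (core_seq N n) /\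
  codim (core_seq N n) <= iter n (fun x => x * (x + 1)) (codim N).
Proof.
move=> cd maxN LI Laut LN; elim: n => //= n [LM leM].
have maxM := max_normal_above_core_seq (n := n) maxN.
set M := core_seq N n in LM leM maxM *.
have [LC leC] := codim_bigmeet (min_cover M).2 cd LI
  (fun i => Laut ((min_cover M).1 i) _ LM) (fun i => codim_aut cd _ LM).
split=> //; apply: le_trans leC _.
have M0 : 0 <= codim M := codim_ge0 cd LM.
have leMM : (min_cover M).2.+1%:R <= codim M + 1.
  by apply: (min_cover_le cd) => // phi; apply: Laut.
apply: (@le_trans _ _ (codim M * (codim M + 1))).
  by rewrite mulrC ler_wpM2l.
(* The function [x (x + 1)] is monotone on nonnegative reals, whence the use of [M0]. *)
by apply: ler_pM => //; rewrite ?addr_ge0 // lerD2r.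
Qed.

Theorem mainTheorem2 (R : realType) (G : groupType) (N : nsubgroup G)
    (hN : max_normal (quotient_group N)) :
  exists H : nat -> nsubgroup G,
  forall t : nat, (1 <= t)%N ->
    [/\ is_characteristic (H t),
        coradical_class_gen (quotient_group N) (quotient_group (H t)) /\
        in_sublattice_gen [set aut_image phi N | phi in [set: aut G]] (H t),
        forall (k : nat) (w : outer_comm k), (k <= t)%N ->
          radical_class_gen (subgroup_group (oc_subgroup w (fun=> N)))
                            (subgroup_group (oc_subgroup w (fun=> H t))) &
        forall codim : nsubgroup G -> R,
          is_gen_codim
            [set K | coradical_class_gen (quotient_group N) (quotient_group K)] codim ->
          codim (H t) <= iter t.-1 (fun x => x * (x + 1)) (codim N)].
Proof.
have maxN := max_normal_above_quotient hN.
have maxM t := max_normal_above_core_seq (n := t) maxN.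
have LH t : coradical_class_gen (quotient_group N)
    (quotient_group (aut_hull (core_seq N t))).
  by move=> C hC CN; apply: coradical_aut_hull => //; apply: coradical_core_seq.
(* The shift makes [H 1] the hull of [N] itself, without any core taken. *)
exists (fun t => aut_hull (core_seq N t.-1)) => t _; split.
- exact: aut_hull_characteristic.
- split=> //; apply: sublattice_bigmul => i; exact: sublattice_core_seq.
- by move=> k w; apply: radical_oc_aut_hull.
- move=> codim cd; have [|phi A LA|//|LM leM] := codim_core_seq t.-1 cd maxN.
  + move=> A B LA LB C hC CN.
    by apply: coradical_quotient_meet; [|apply: LA|apply: LB].
  + move=> C hC CN; apply: (coradical_iso hC (aut_quotient_isomorphic phi A)).
    exact: LA.
  (* The hull contains the core it is built from, so (1) bounds its codimension by that of
     [core_seq N t.-1]. *)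
  apply: le_trans leM; apply: (codim_anti cd (LH t.-1) LM).
  exact: sub_aut_hull_id.
Qed.
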